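(* There is a monotonically shrinking temporal path $\mathcal{P}$ consisting of two layers which only differ in one edge such that there is no Nash equilibrium in the two-player temporal diffusion game $\mathrm{Diff}(\mathcal{P},2)$.
   Context: A temporal graph $\mathcal{G}=(V,(E_t)_{t=1}^\infty)$ consists of a finite vertex set $V$ and edge sets $E_t\subseteq\binom{V}{2}$; its $t$-th layer is $G_t=(V,E_t)$. When only $E_1,\dots,E_\tau$ are specified (''$\tau$ layers''), $E_t=E_\tau$ for all $t>\tau$. The underlying graph is $(V,\bigcup_t E_t)$. A temporal path is a temporal graph whose underlying graph is a path. $\mathcal{G}$ is monotonically shrinking if $E_{t+1}\subseteq E_t$ for all $t$. Two-player temporal diffusion game $\mathrm{Diff}(\mathcal{G},2)$: players $1,2$ choose vertices $p_1,p_2\in V$ simultaneously. At time $0$, if $p_1\ne p_2$ then $p_i$ gets color $i$; if $p_1=p_2$ this vertex is colored gray. For $t=1,2,\dots$, in step $t$ each uncolored vertex having a neighbor in $G_t$ of color $i\in\{1,2\}$ and no neighbor in $G_t$ of the other player's color gets color $i$; each uncolored vertex having neighbors in $G_t$ of both colors $1$ and $2$ becomes gray. Gray does not spread, and colors never change. The payoff of player $i$ is the final number of vertices of color $i$. A profile $(p_1,p_2)$ is a Nash equilibrium if no player can strictly increase her payoff by unilaterally choosing another vertex. *)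

(* Defs.v *)
From HB Require Import structures.
From mathcomp Require Import all_boot.
From mathcomp Require Import boolp.

Set Implicit Arguments.
Unset Strict Implicit.
Unset Printing Implicit Defensive.

(* [layer G t] is the edge set [E_t] for [t >= 1]; time starts at 1, and the
   value [layer G 0] is junk that no definition below looks at. *)
Record tgraph (V : finType) := TGraph {
  layer : nat -> {set {set V}};
  layer_card2 : forall t (e : {set V}), e \in layer t -> #|e| = 2
}.

Definition underlying_edge (V : finType) (G : tgraph V) (e : {set V}) : Prop :=
  exists2 t, 0 < t & e \in layer G t.

(* The vertices of the path, in order, are [f 0, ..., f n]. *)
Definition temporal_path (V : finType) (G : tgraph V) : Prop :=
  exists (n : nat) (f : 'I_n.+1 -> V), bijective f /\
    forall e : {set V}, underlying_edge G e <->
      exists i j : 'I_n.+1, j = i.+1 :> nat /\ e = [set f i; f j].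

Definition monotonically_shrinking (V : finType) (G : tgraph V) : Prop :=
  forall t, 0 < t -> layer G t.+1 \subset layer G t.

(* [G] is specified by [E_1, ..., E_tau], the last layer being repeated. *)
Definition consists_of_layers (V : finType) (G : tgraph V) (tau : nat) : Prop :=
  0 < tau /\ forall t, tau < t -> layer G t = layer G tau.

Definition differ_in_one_edge (V : finType) (E F : {set {set V}}) : Prop :=
  #|(E :\: F) :|: (F :\: E)| = 1.

Inductive color := Uncolored | Color1 | Color2 | Gray.

Definition color_eqb (c d : color) : bool :=
  match c, d with
  | Uncolored, Uncolored | Color1, Color1 | Color2, Color2 | Gray, Gray => true
  | _, _ => false
  end.

Lemma color_eqP : Equality.axiom color_eqb.
Proof. by case; case; constructor. Qed.

HB.instance Definition _ := hasDecEq.Build color color_eqP.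

Definition initial_coloring (V : finType) (p : V * V) (v : V) : color :=
  if p.1 == p.2 then (if v == p.1 then Gray else Uncolored)
  else if v == p.1 then Color1
  else if v == p.2 then Color2
  else Uncolored.

Definition has_neighbor_colored (V : finType) (E : {set {set V}})
    (c : V -> color) (v : V) (k : color) : bool :=
  [exists u : V, ([set u; v] \in E) && (c u == k)].

Definition diffusion_step (V : finType) (E : {set {set V}})
    (c : V -> color) (v : V) : color :=
  if c v is Uncolored then
    match has_neighbor_colored E c v Color1,
          has_neighbor_colored E c v Color2 with
    | true, true => Gray
    | true, false => Color1
    | false, true => Color2
    | false, false => Uncolored
    end
  else c v.

Fixpoint coloring (V : finType) (G : tgraph V) (p : V * V) (t : nat)
    : V -> color :=
  if t is t'.+1 then diffusion_step (layer G t) (coloring G p t')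
  else initial_coloring p.

(* Colors never change, so the final color of [v] is [k <> Uncolored] iff
   [v] has color [k] at some time. *)
Definition final_count (V : finType) (G : tgraph V) (p : V * V) (k : color)
    : nat :=
  #|[set v : V | `[< exists t, coloring G p t v = k >]]|.

Definition payoff1 (V : finType) (G : tgraph V) (p : V * V) : nat :=
  final_count G p Color1.

Definition payoff2 (V : finType) (G : tgraph V) (p : V * V) : nat :=
  final_count G p Color2.

Definition nash_equilibrium (V : finType) (G : tgraph V) (p : V * V) : Prop :=
  (forall v : V, payoff1 G (v, p.2) <= payoff1 G p) /\
  (forall v : V, payoff2 G (p.1, v) <= payoff2 G p).

(* Main.v *)
(** Take the path 0 - 1 - ... - 7 whose edge {1,2} is present in step 1 only.
The game is symmetric in the two players, so (p, q) is an equilibrium iff p and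
q are best responses to each other.  The best responses to 0, ..., 7 are
  0: {1}   1: {2}   2: {3}   3: {4}   4: {1,2,5}   5: {2}   6: {1,2,5}   7: {2,6}
so no two vertices are best responses to each other.  Every coloring is final
after 7 steps, which makes the payoffs computable. *)
Require Import Defs.
From mathcomp Require Import all_boot.
From mathcomp Require Import boolp.

Set Implicit Arguments.
Unset Strict Implicit.
Unset Printing Implicit Defensive.

(** Here [i] stands for the edge {i, i+1}, named by its smaller endpoint. *)
Definition edge_present (t i : nat) : bool := (t <= 1) || (i != 1).

Definition layer_adj (t i j : nat) : bool :=
  (j == i.+1) && edge_present t i || (i == j.+1) && edge_present t j.

Definition path8_layer (t : nat) : {set {set 'I_8}} :=
  [set [set e.1; e.2] | e : 'I_8 * 'I_8
                      & (e.2 == e.1.+1 :> nat) && edge_present t e.1].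

Lemma path8_layerP (t : nat) (e : {set 'I_8}) :
  reflect (exists i j : 'I_8,
             [/\ j = i.+1 :> nat, edge_present t i & e = [set i; j]])
          (e \in path8_layer t).
Proof.
apply: (iffP imsetP) => [[[i j]]|[i [j [ji ti ->]]]].
  by rewrite inE => /= /andP[/eqP ji ti] ->; exists i, j.
by exists (i, j); rewrite // inE /= ji eqxx.
Qed.

Lemma eq_set2 (T : finType) (a b c d : T) :
  [set a; b] = [set c; d] -> a = c /\ b = d \/ a = d /\ b = c.
Proof.
move=> E.
have /set2P[] : a \in [set c; d] by rewrite -E set21.
all: have /set2P[] : b \in [set c; d] by rewrite -E set22.
all: have /set2P[] : c \in [set a; b] by rewrite E set21.
all: have /set2P[] : d \in [set a; b] by rewrite E set22.
all: by move=> *; subst; auto.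
Qed.

Lemma mem_path8_layer (t : nat) (u v : 'I_8) :
  ([set u; v] \in path8_layer t) = layer_adj t u v.
Proof.
apply/path8_layerP/orP => [[i [j [ji ti /eq_set2[[-> ->]|[-> ->]]]]]|].
- by left; rewrite ji eqxx.
- by right; rewrite ji eqxx.
by case=> /andP[/eqP E te]; [exists u, v | exists v, u; rewrite setUC].
Qed.

Lemma path8_layer_card2 (t : nat) (e : {set 'I_8}) :
  e \in path8_layer t -> #|e| = 2.
Proof.
case/path8_layerP=> i [j [ji _ ->]].
by rewrite cards2 -val_eqE /= ji neq_ltn ltnSn.
Qed.

Definition path8 : tgraph 'I_8 := TGraph path8_layer_card2.

Lemma path8_temporal_path : temporal_path path8.
Proof.
exists 7, id; split; first by exists id.
move=> e; split=> [[t _ /path8_layerP[i [j [ji _ ->]]]]|[i [j [ji ->]]]].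
  by exists i, j.
(* The first layer already contains every edge of the path. *)
by exists 1 => //; apply/path8_layerP; exists i, j.
Qed.

Lemma path8_layer_constant (t : nat) : 1 < t -> path8_layer t = path8_layer 2.
Proof.
move=> t1; rewrite /path8_layer (_ : edge_present t = edge_present 2) //.
by rewrite /edge_present leqNgt t1.
Qed.

Lemma path8_layer_sub1 (t : nat) : path8_layer t \subset path8_layer 1.
Proof.
apply/subsetP=> e /path8_layerP[i [j [ji _ ->]]].
by apply/path8_layerP; exists i, j.
Qed.

Lemma path8_shrinking : monotonically_shrinking path8.
Proof.
(* Only the inclusion of layer 2 in layer 1 is proper; later layers coincide. *)
case=> // -[|t] _ /=; first exact: path8_layer_sub1.
by rewrite !path8_layer_constant.
Qed.

Lemma path8_differ_in_one_edge : differ_in_one_edge (layer path8 1) (layer path8 2).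
Proof.
rewrite /differ_in_one_edge /=.
have /eqP -> : path8_layer 2 :\: path8_layer 1 == set0.
  by rewrite setD_eq0 path8_layer_sub1.
rewrite setU0; apply/eqP/cards1P; exists [set inord 1; inord 2].
apply/setP=> e; rewrite in_set1 in_setD.
apply/andP/eqP => [[e2 /path8_layerP[i [j [ji _ E]]]]|->].
  (* Absence of {i, i+1} from layer 2 forces [i = 1]. *)
  move: e2; rewrite {}E mem_path8_layer /layer_adj ji eqxx /= negb_or negbK.
  case/andP=> /eqP i1 _; congr [set _; _]; apply: val_inj.
    by rewrite /= inordK.
  by rewrite /= inordK // ji i1.
by rewrite !mem_path8_layer !inordK.
Qed.

(** From here the game is replayed on natural numbers, a coloring being the list of the colors of 0,
    ..., 7, so that [vm_compute] can evaluate it. *)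
Definition sim_init (p q v : nat) : color :=
  if p == q then (if v == p then Gray else Uncolored)
  else if v == p then Color1
  else if v == q then Color2
  else Uncolored.

Definition sim_neighbor (t : nat) (s : seq color) (v : nat) (k : color) : bool :=
  has (fun u => layer_adj t u v && (nth Uncolored s u == k)) (iota 0 8).

Definition sim_step (t : nat) (s : seq color) (v : nat) : color :=
  let c := nth Uncolored s v in
  if c is Uncolored then
    match sim_neighbor t s v Color1, sim_neighbor t s v Color2 with
    | true, true => Gray
    | true, false => Color1
    | false, true => Color2
    | false, false => Uncolored
    end
  else c.

Fixpoint sim (p q t : nat) : seq color :=
  if t is t'.+1 then mkseq (sim_step t (sim p q t')) 8
  else mkseq (sim_init p q) 8.

Lemma simS (p q t : nat) :
  sim p q t.+1 = mkseq (sim_step t.+1 (sim p q t)) 8.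
Proof. by []. Qed.

Lemma size_sim (p q t : nat) : size (sim p q t) = 8.
Proof. by case: t => [|t]; rewrite size_mkseq. Qed.

Lemma has_neighbor_coloredE (t : nat) (c : 'I_8 -> color) (s : seq color)
    (v : 'I_8) (k : color) :
  (forall u : 'I_8, c u = nth Uncolored s u) ->
  has_neighbor_colored (path8_layer t) c v k = sim_neighbor t s v k.
Proof.
move=> cE; apply/existsP/hasP => [[u]|[u]].
  rewrite mem_path8_layer cE => H; exists (val u) => //.
  by rewrite mem_iota ltn_ord.
rewrite mem_iota => /andP[_ u8] H; exists (Ordinal u8).
by rewrite mem_path8_layer cE.
Qed.

Lemma coloring_sim (p : 'I_8 * 'I_8) (t : nat) (v : 'I_8) :
  coloring path8 p t v = nth Uncolored (sim p.1 p.2 t) v.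
Proof.
elim: t v => [|t IH] v; first by rewrite nth_mkseq.
by rewrite simS nth_mkseq //= /diffusion_step /sim_step IH
  !(has_neighbor_coloredE _ _ _ IH).
Qed.

(** A step alters uncolored vertices only. *)
Lemma coloring_persists (V : finType) (G : tgraph V) (p : V * V) (t d : nat)
    (v : V) (k : color) :
  k != Uncolored -> coloring G p t v = k -> coloring G p (t + d) v = k.
Proof.
move=> k0 ctk; elim: d => [|d IH]; first by rewrite addn0.
by rewrite addnS /= /diffusion_step IH; case: k k0 {ctk IH}.
Qed.

(** Evaluation on all 64 profiles shows that step 8 changes nothing; every later step uses the same
    layer, so it changes nothing either. *)
Lemma sim_stable (p q : 'I_8) (d : nat) : sim p q (7 + d) = sim p q 7.
Proof.
have fix7 : sim p q 8 = sim p q 7.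
  have /allP/(_ (val p))/[!mem_iota]/(_ (ltn_ord p))/allP/(_ (val q)) :
    all (fun p => all (fun q => sim p q 8 == sim p q 7) (iota 0 8)) (iota 0 8).
    by vm_compute.
  by rewrite mem_iota => /(_ (ltn_ord q))/eqP.
elim: d => [|d IH]; first by rewrite addn0.
rewrite addnS -[RHS]fix7 simS IH [RHS]simS; apply: eq_map => v.
(* The test [t <= 1] computes to [false] both at step 8 and at step 8 + d. *)
by rewrite /sim_step /sim_neighbor /layer_adj /edge_present.
Qed.

Definition sim_payoff (k : color) (p q : nat) : nat :=
  count (pred1 k) (sim p q 7).

(** A color taken at some time t is still there at time 7 + t, where the coloring agrees with that
    at time 7. *)
Lemma final_count_sim (p : 'I_8 * 'I_8) (k : color) :
  k != Uncolored -> final_count path8 p k = sim_payoff k p.1 p.2.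
Proof.
move=> k0; rewrite /final_count /sim_payoff.
(* Both sides become counts over the enumeration of ['I_8]. *)
rewrite -[in RHS](mkseq_nth Uncolored (sim _ _ _)) size_sim /mkseq.
rewrite -val_enum_ord -map_comp count_map enumT cardE size_filter.
apply: eq_count => v; rewrite !inE /=.
apply/asboolP/eqP => [[t ctk]|<-]; last by exists 7; rewrite coloring_sim.
by have := coloring_persists 7 k0 ctk; rewrite addnC coloring_sim sim_stable.
Qed.

Definition sim_improvable (p q : nat) : bool :=
  has (fun v => sim_payoff Color1 p q < sim_payoff Color1 v q) (iota 0 8) ||
  has (fun v => sim_payoff Color2 p q < sim_payoff Color2 p v) (iota 0 8).

(** The 64 profiles are checked by evaluation, in place of deriving the table of best responses. *)
Lemma path8_improvable (p q : 'I_8) : sim_improvable p q.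
Proof.
have /allP/(_ (val p))/[!mem_iota]/(_ (ltn_ord p))/allP/(_ (val q)) :
  all (fun p => all (sim_improvable p) (iota 0 8)) (iota 0 8) by vm_compute.
by rewrite mem_iota => /(_ (ltn_ord q)).
Qed.

Theorem theorem4 :
  exists (V : finType) (P : tgraph V),
    [/\ temporal_path P,
        monotonically_shrinking P,
        consists_of_layers P 2,
        differ_in_one_edge (layer P 1) (layer P 2)
      & ~ exists p : V * V, nash_equilibrium P p].
Proof.
exists 'I_8, path8; split.
- exact: path8_temporal_path.
- exact: path8_shrinking.
- by split=> // t /ltnW/path8_layer_constant.
- exact: path8_differ_in_one_edge.
(* The improving vertex [v], for player 1 or for player 2, contradicts the equilibrium condition of
   that player. *)
case=> -[p q] [ne1 ne2]; have /orP[] := path8_improvable p q => /hasP[v].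
  rewrite mem_iota => /andP[_ v8]; apply/negP; rewrite -leqNgt.
  by have := ne1 (Ordinal v8); rewrite /payoff1 !final_count_sim.
rewrite mem_iota => /andP[_ v8]; apply/negP; rewrite -leqNgt.
by have := ne2 (Ordinal v8); rewrite /payoff2 !final_count_sim.
Qed.
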